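(* Let $n$ be a positive even integer. If $G$ is a connected graph of order $n$ with minimum degree $\delta(G)\geq \frac{n}{2}+1$, then $G$ has an odd spanning tree.
   Context: All graphs are finite and simple. An odd spanning tree of $G$ is a spanning tree of $G$ in which every vertex has odd degree. *)

(* Defs.v *)
From mathcomp Require Import all_boot.

Set Implicit Arguments.
Unset Strict Implicit.
Unset Printing Implicit Defensive.

Record sgraph (T : finType) := SGraph {
  adj :> rel T;
  adj_sym : symmetric adj;
  adj_irr : irreflexive adj
}.

Section Graph.
Variable T : finType.
Implicit Types G H : sgraph T.

Definition degree G (x : T) : nat := #|[set y | G x y]|.

(* The default value #|T| exceeds every degree, so it is only attained when
   T is empty. *)
Definition min_degree G : nat := \big[minn/#|T|]_(x : T) degree G x.

Definition connected G : Prop := forall x y : T, connect G x y.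

(* The length bound is needed because [:: x; y] is a ucycle for any edge xy. *)
Definition acyclic G : Prop := forall c : seq T, 2 < size c -> ~ ucycle G c.

Definition is_tree G : Prop := connected G /\ acyclic G.

(* H has the same vertex type as G, so a subgraph of this form is spanning. *)
Definition spanning_tree G H : Prop := subrel H G /\ is_tree H.

Definition odd_spanning_tree G H : Prop :=
  spanning_tree G H /\ forall x : T, odd (degree H x).

Lemma min_degree_le G x : min_degree G <= degree G x.
Proof.
rewrite /min_degree; have := mem_index_enum x.
elim: (index_enum T) => // y s IHs; rewrite inE big_cons geq_min.
by case/predU1P=> [<-|/IHs->]; rewrite ?leqnn ?orbT.
Qed.

Lemma min_degree_attained G : 0 < #|T| -> exists x, degree G x = min_degree G.
Proof.
case/card_gt0P=> x0 _; case: (arg_minnP (degree G) (erefl : xpredT x0)) => x _ xmin.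
exists x; apply/eqP; rewrite eqn_leq min_degree_le andbT /min_degree.
apply: (big_ind (leq (degree G x))) => [|m n xm xn|y _]; last exact: xmin.
  exact: max_card.
by rewrite leq_min xm.
Qed.

End Graph.

(* Main.v *)
Require Import Defs.
From mathcomp Require Import all_boot.
From mathcomp Require Import zify.

Set Implicit Arguments.
Unset Strict Implicit.
Unset Printing Implicit Defensive.

(** Grow an odd tree from a single edge by attaching two leaves at once to the
    same vertex, which preserves all parities and keeps the order even. If the
    tree has vertex set [S] and [s = n - #|S| > 0], then [s >= 2] and such a
    step is possible: otherwise every vertex of [S] has at most one neighbour
    outside [S]. It then has at least [n/2] neighbours in [S], so
    [s <= n/2 - 1]; and counting the edges leaving [S] from both ends gives
    [s (n/2 + 2 - s) <= n - s], which fails for [2 <= s <= n/2 - 1]. *)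

Section PartialTrees.
Variable T : finType.
Implicit Types (G H : sgraph T) (S R : {set T}).

(** [H] keeps the full vertex type [T], so growing a tree never changes types: by symmetry the
    second clause puts both ends of every edge in [S], and vertices outside [S] are isolated. *)
Definition tree_on G H S : Prop :=
  [/\ subrel H G, forall x y, H x y -> x \in S,
      {in S &, forall x y, connect H x y} & acyclic H].

Definition add_edge_rel H (v r : T) : rel T :=
  fun x y => [|| H x y, (x == v) && (y == r) | (x == r) && (y == v)].

Lemma add_edge_sym H v r : symmetric (add_edge_rel H v r).
Proof.
move=> x y; rewrite /add_edge_rel adj_sym.
by congr (_ || _); rewrite orbC; congr (_ || _); rewrite andbC.
Qed.

Lemma add_edge_irr H v r : v != r -> irreflexive (add_edge_rel H v r).
Proof.
by move=> vr x; rewrite /add_edge_rel adj_irr /=; case: eqP => [->|] //=;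
   rewrite ?(negPf vr) ?andbF.
Qed.

Definition add_edge H v r (vr : v != r) : sgraph T :=
  SGraph (@add_edge_sym H v r) (add_edge_irr H vr).

(** In the new graph [v] is the only neighbour of [r], so no cycle passes through [r]; a cycle
    avoiding [r] already lies in [H]. *)
Lemma tree_on_add_leaf G H S v r (vr : v != r) :
  tree_on G H S -> v \in S -> r \notin S -> G v r ->
  tree_on G (add_edge H vr) (r |: S).
Proof.
move=> [HG HS Hc Ha] vS rS Gvr; set H' := add_edge H vr.
have rN x : H' r x -> x = v.
  case/or3P=> [/HS|/andP[/eqP E _]|/andP[_ /eqP]] //; first by rewrite (negPf rS).
  by have := vr; rewrite E eqxx.
have Nr x : H' x r -> x = v by rewrite adj_sym => /rN.
have subH : subrel (connect H) (connect H').
  by apply: connect_sub => x y Hxy; apply: connect1; rewrite /H' /= /add_edge_rel Hxy.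
have H'vr : H' v r by rewrite /= /add_edge_rel !eqxx orbT.
have cs : connect_sym H' by apply: sym_connect_sym; apply: adj_sym.
have toV x : x \in r |: S -> connect H' x v.
  case/setU1P => [->|xS]; first by rewrite cs connect1.
  by apply: subH; apply: Hc.
split.
- move=> x y /or3P[/HG//|/andP[/eqP-> /eqP->]//|/andP[/eqP-> /eqP->]].
  by rewrite adj_sym.
- move=> x y /or3P[/HS xS|/andP[/eqP-> _]|/andP[/eqP-> _]].
  + by rewrite in_setU1 xS orbT.
  + by rewrite in_setU1 vS orbT.
  + by rewrite setU11.
- by move=> x y /toV xv /toV yv; apply: connect_trans xv _; rewrite cs.
move=> c c2 /andP[cyc uc]; case: (boolP (r \in c)) => rc.
  (* Rotate the cycle to start at [r]. Its length exceeds 2, so the second vertex [y] and the last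
     vertex [z] are distinct; yet both are neighbours of [r], hence equal to [v]. *)
  case: (rot_to rc) => i p def_p.
  have := cyc; rewrite -(rot_cycle i) def_p /=.
  have := uc; rewrite -(rot_uniq i) def_p.
  have := c2; rewrite -(size_rot i) def_p.
  case/lastP: p {def_p} => // [[|y p]] z //= _.
  rewrite mem_rcons inE => /and3P[_ /norP[yz _] _].
  rewrite rcons_path last_rcons => /and3P[/rN Ey _ /Nr Ez].
  by rewrite Ey Ez eqxx in yz.
apply: (Ha c c2); rewrite /ucycle /ucycleb uc andbT.
apply: (@sub_in_cycle _ (predC1 r) H' H) cyc => //.
  move=> x y; rewrite !inE => xr yr.
  by case/or3P=> [//|/andP[_ E]|/andP[E _]]; rewrite E in xr yr.
by apply/allP => x xc; apply: contraNneq rc => <-.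
Qed.

Lemma degree_add_leaf G H S v r (vr : v != r) x :
  tree_on G H S -> r \notin S ->
  degree (add_edge H vr) x = degree H x + (x == v) + (x == r).
Proof.
move=> [_ HS _ _] rS.
have Hr y : H y r = false.
  by apply/negP; rewrite adj_sym => /HS; rewrite (negPf rS).
rewrite /degree; case: (eqVneq x v) => [->|xv] /=.
  rewrite (negPf vr) addn0 addn1.
  have -> : [set y | add_edge H vr v y] = r |: [set y | H v y].
    apply/setP => y; rewrite !inE /= /add_edge_rel eqxx (negPf vr) /=.
    by rewrite orbF orbC.
  by rewrite cardsU1 inE Hr.
rewrite addn0; case: (eqVneq x r) => [->|xr] /=.
  have -> : [set y | add_edge H vr r y] = v |: [set y | H r y].
    apply/setP => y; rewrite !inE /= /add_edge_rel eqxx.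
    by rewrite (eq_sym r v) (negPf vr) /= orbC.
  by rewrite cardsU1 inE adj_sym Hr addnC.
rewrite addn0; apply: eq_card => y.
by rewrite !inE /= /add_edge_rel (negPf xv) (negPf xr) !orbF.
Qed.

Lemma tree_on_singleton G (x : T) :
  exists2 H, tree_on G H [set x] & forall y, degree H y = 0.
Proof.
pose H := @SGraph T (fun _ _ => false) (fun _ _ => erefl) (fun _ => erefl).
exists H; last first.
  by move=> y; apply/eqP; rewrite cards_eq0; apply/eqP/setP => z; rewrite !inE.
split=> // [y z /set1P-> /set1P->|]; first exact: connect0.
by move=> [|a [|b c]].
Qed.

Definition odd_tree_on G H S : Prop :=
  tree_on G H S /\ {in S, forall x, odd (degree H x)}.

Lemma odd_tree_on_edge G x y :
  G x y -> exists2 H, odd_tree_on G H [set x; y] & x != y.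
Proof.
move=> Gxy; have xy : x != y by apply: contraTneq Gxy => ->; rewrite adj_irr.
case: (tree_on_singleton G x) => H tH dH.
have yx : y \notin [set x] by rewrite inE eq_sym.
exists (add_edge H xy) => //; split.
  by rewrite setUC; apply: tree_on_add_leaf => //; rewrite set11.
move=> z; rewrite (degree_add_leaf _ _ tH yx) dH !inE.
case/orP=> /eqP->; rewrite eqxx ?(negPf xy) //.
by rewrite eq_sym (negPf xy).
Qed.

Lemma odd_tree_on_add_two_leaves G H S v r1 r2 :
  odd_tree_on G H S -> v \in S -> r1 \notin S -> r2 \notin S -> r1 != r2 ->
  G v r1 -> G v r2 -> exists H', odd_tree_on G H' (r2 |: (r1 |: S)).
Proof.
move=> [tH oH] vS r1S r2S r12 Gv1 Gv2.
have v1 : v != r1 by apply: contraNneq r1S => <-.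
have v2 : v != r2 by apply: contraNneq r2S => <-.
have tH1 := tree_on_add_leaf v1 tH vS r1S Gv1.
have r2S1 : r2 \notin r1 |: S by rewrite in_setU1 negb_or eq_sym r12.
have vS1 : v \in r1 |: S by rewrite in_setU1 vS orbT.
exists (add_edge (add_edge H v1) v2); split; first exact: tree_on_add_leaf.
have d0 r : r \notin S -> degree H r = 0.
  move=> rS; apply/eqP; rewrite cards_eq0; apply/eqP/setP => z; rewrite !inE.
  by case: tH => _ HS _ _; apply/negP => /HS; rewrite (negPf rS).
move=> x xS; rewrite (degree_add_leaf _ _ tH1 r2S1) (degree_add_leaf _ _ tH r1S).
move: xS; rewrite !inE => /or3P[/eqP->|/eqP->|xS].
- by rewrite d0 // eqxx (eq_sym r2 v) (negPf v2) (eq_sym r2 r1) (negPf r12).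
- by rewrite d0 // eqxx (eq_sym r1 v) (negPf v1) (negPf r12).
have x1 : x != r1 by apply: contraNneq r1S => <-.
have x2 : x != r2 by apply: contraNneq r2S => <-.
(* An old vertex gains [(x == v)] twice, which cancels modulo 2. *)
by rewrite (negPf x1) (negPf x2) !addn0 !oddD addbK oH.
Qed.

Lemma degree_split G S x :
  degree G x = #|[set y in S | G x y]| + #|[set y in ~: S | G x y]|.
Proof.
rewrite /degree -(cardsID S); congr (_ + _); apply: eq_card => y;
  by rewrite !inE andbC.
Qed.

Lemma card_nbr_lt G S x : x \in S -> #|[set y in S | G x y]| < #|S|.
Proof.
move=> xS; rewrite [ltnRHS](cardsD1 x) xS ltnS subset_leq_card //.
apply/subsetP => y; rewrite !inE => /andP[-> Gxy]; rewrite andbT.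
by apply: contraTneq Gxy => ->; rewrite adj_irr.
Qed.

(** Both sides count the pairs in [S] times [R] that are adjacent in [G]. *)
Lemma double_count_edges G S R :
  \sum_(x in S) #|[set y in R | G x y]| = \sum_(y in R) #|[set x in S | G y x]|.
Proof.
have cE x (A : {set T}) : #|[set y in A | G x y]| = \sum_(y in A) (G x y : nat).
  by rewrite -sum1dep_card big_mkcondr; apply: eq_bigr => y _; case: (G x y).
under eq_bigr do rewrite cE; rewrite exchange_big; apply: eq_bigr => y _.
by rewrite cE; apply: eq_bigr => x _; rewrite adj_sym.
Qed.

Lemma vertex_with_two_outer_neighbours G S (m : nat) :
  #|T| = m.*2 -> (forall x, m < degree G x) ->
  S != set0 -> 1 < #|~: S| ->
  exists2 v, v \in S & 1 < #|[set y in ~: S | G v y]|.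
Proof.
move=> nT dG /set0Pn[x xS] s2; apply/exists_inP; apply: contraT.
rewrite negb_exists_in => /forall_inP noV.
have le1 v : v \in S -> #|[set y in ~: S | G v y]| <= 1.
  by move=> /noV; rewrite -leqNgt.
have cT := cardsC S; rewrite nT in cT.
(* At most one neighbour of [x] lies outside [S], so at least [m] lie inside, and [x] itself is a
   further element of [S]. *)
have tS : m < #|S|.
  have := dG x; rewrite (degree_split G S) => dx.
  have := card_nbr_lt G xS; have := le1 x xS; lia.
have edges_le : \sum_(y in ~: S) #|[set z in S | G y z]| <= #|S|.
  rewrite -double_count_edges -sum1_card; exact: leq_sum.
(* A vertex outside [S] has at most [#|~: S| - 1] of its at least [m + 1] neighbours outside [S]. *)
have edges_ge : #|~: S| * (m.+2 - #|~: S|) <= \sum_(y in ~: S) #|[set z in S | G y z]|.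
  rewrite -sum_nat_const; apply: leq_sum => y yS.
  have := dG y; rewrite (degree_split G S); have := card_nbr_lt G yS; lia.
have := leq_trans edges_ge edges_le.
(* The truncated subtraction is exact, because [#|~: S| < m]. The contradiction then comes from [s
   (m + 2 - s) = (2m - s) + (s - 2)(m + 1 - s) + 2], where [2m - s = t]. *)
have : m.+2 - #|~: S| + #|~: S| = m.+2 by lia.
move: tS cT s2; move: (#|S|) (#|~: S|) => t s tS cT s2; nia.
Qed.

Lemma odd_tree_on_full G H : odd_tree_on G H setT -> odd_spanning_tree G H.
Proof.
case=> [[HG _ Hc Ha] oH]; split; last by move=> x; apply: oH.
by split=> //; split=> // x y; apply: Hc.
Qed.

(** Induction on a strict bound [k] for the number of vertices outside [S], which drops by two at
    each step. *)
Lemma odd_tree_on_extend G H S (m : nat) :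
  #|T| = m.*2 -> (forall x, m < degree G x) ->
  S != set0 -> ~~ odd #|S| -> odd_tree_on G H S ->
  exists H', odd_spanning_tree G H'.
Proof.
move=> nT dG; have [k] := ubnP #|~: S|; elim: k => // k IHk in H S *.
rewrite ltnS => Sk S0 eS oH; have cT := cardsC S; rewrite nT in cT.
case: (posnP #|~: S|) => [s0|s_gt0].
  exists H; apply: odd_tree_on_full.
  by rewrite -(setCK setT) setCT -(cards0_eq s0) setCK.
(* Both [#|T|] and [#|S|] are even, so a nonempty complement has at least two elements. *)
have s2 : 1 < #|~: S| by lia.
have [v vS /card_gt1P[r1 [r2 []]]] := vertex_with_two_outer_neighbours nT dG S0 s2.
rewrite !inE => /andP[r1S Gv1] /andP[r2S Gv2] r12.
have [H' oH'] := odd_tree_on_add_two_leaves oH vS r1S r2S r12 Gv1 Gv2.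
have cS : #|r2 |: (r1 |: S)| = #|S|.+2.
  by rewrite !cardsU1 in_setU1 negb_or eq_sym r12 r1S r2S.
have := cardsC (r2 |: (r1 |: S)); rewrite nT => cT'.
by apply: IHk oH'; [lia | rewrite -card_gt0 cS | rewrite cS /= negbK].
Qed.

End PartialTrees.

Theorem theorem2p6 (n : nat) (T : finType) (G : sgraph T) :
  0 < n -> ~~ odd n -> #|T| = n ->
  connected G -> n./2 + 1 <= min_degree G ->
  exists H : sgraph T, odd_spanning_tree G H.
Proof.
move=> n0 en nT _ dG.
have nT2 : #|T| = n./2.*2 by rewrite nT even_halfK.
have dG' x : n./2 < degree G x.
  by have := leq_trans dG (min_degree_le G x); rewrite addn1.
have /card_gt0P[x _] : 0 < #|T| by rewrite nT.
(* Any edge serves as the initial tree: both of its ends have degree 1. *)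
have /card_gt0P[y] : 0 < degree G x by apply: leq_ltn_trans (dG' x).
rewrite inE => Gxy; have [H oH xy] := odd_tree_on_edge Gxy.
apply: odd_tree_on_extend nT2 dG' _ _ oH; last by rewrite cards2 xy.
by apply/set0Pn; exists x; rewrite set21.
Qed.
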